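(* Let $G$ be a finite insoluble group. Then $|\mathrm{Sol}_G(x)|\geq 10$ for all elements $x\in G$.
   Context: For a finite group $G$ and $x \in G$, the solubilizer of $x$ in $G$ is the subset $\mathrm{Sol}_G(x)=\{y \in G \mid \langle x,y\rangle \text{ is soluble}\}$ (not a subgroup in general). Insoluble means not soluble. *)

(* Defs.v *)
From mathcomp Require Import all_boot all_fingroup all_solvable.
Set Implicit Arguments.
Unset Strict Implicit.
Unset Printing Implicit Defensive.

Local Open Scope group_scope.

Definition solubilizer (gT : finGroupType) (G : {set gT}) (x : gT) : {set gT} :=
  [set y in G | solvable <<[set x; y]>>].

(* Main.v *)
Require Import Defs.
From mathcomp Require Import all_boot all_fingroup all_solvable.
From mathcomp Require Import all_order all_algebra all_field all_character.
From mathcomp Require Import zify ring.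

(** Let S be the solubilizer of x, and suppose |S| <= 9; then G is soluble. Every
soluble subgroup through x lies in S, so has order at most 9; by Burnside's
p^a q^b theorem this applies to every subgroup of order less than 30.

If x^2 is central, then x and any conjugate y of x have x y^-1 inverted by x, so
S contains both C_G(x) and the class of x, and |G| <= 81 is small enough.

If x is a p-element in a Sylow subgroup P, then |P| <= 9, and |P| >= 4 forces
N_G(P) = P. When P is abelian, Burnside's transfer theorem gives a normal
complement K, and the P-invariant Sylow subgroups of K are so small that K is a
{2,3}-group. The nonabelian case is |P| = 8 and |x| = 4: there <x> contains the
focal subgroup, and transfer yields a normal subgroup with Sylow subgroup <x>.
For |P| = 3 the critical case is C_G(x) = <x> with x conjugate to its inverse.
If a, b, ab are conjugates of x then <a, b> is soluble, so a class structure
constant is at most 1; the three irreducible characters not vanishing at x then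
give |G| <= 9.

The only other case, |x| = 6, follows from Burnside transfer for both primes. *)

Set Implicit Arguments.
Unset Strict Implicit.
Unset Printing Implicit Defensive.
Import FiniteModule.
Local Open Scope group_scope.

(** * Transfer *)

(** [K] is the kernel of the transfer from [G] to [P / D]. Conjugates inside [P] agree modulo [D],
    so on [P] the transfer is the power map with exponent |G : P|, and this map is injective on
    [P / D] because the index is prime to p. *)
Lemma transfer_kernel (gT : finGroupType) (p : nat) (G P D : {group gT}) :
    p.-Sylow(G) P -> D <| P -> abelian (P / D) ->
    {in P & G, forall u g, u ^ g \in P -> u ^ g * u^-1 \in D} ->
  exists K : {group gT},
    [/\ K <| G, K :&: P = D, abelian (G / K) & p.-group (G / K)].
Proof.
move=> sylP nsDP abPD fusD.
have [sPG pP _] := and3P sylP; have [sDP nDP] := andP nsDP.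
pose alpha := restrm_morphism nDP (coset_morphism D).
have im_alpha: alpha @* P = P / D by rewrite morphim_restrm setIid.
have abA: abelian (alpha @* P) by rewrite im_alpha.
pose V := transfer_morphism G abA.
have isoGK: G / 'ker V \isog V @* G by apply: first_isog.
have pA: p.-group (V @* G).
  have injv : 'injm (fmval_morphism abA) by apply/injmP=> u v _ _; apply: val_inj.
  rewrite /pgroup -(card_injm injv) ?subsetT //.
  apply: pgroupS (_ : p.-group (alpha @* P)); last by rewrite /= im_alpha quotient_pgroup.
  by apply/subsetP=> _ /morphimP[u _ _ ->]; apply: fmodP.
have fmE u : u \in P -> (fmod abA (alpha u) == 0)%R = (u \in D).
  move=> Pu; rewrite -(inj_eq val_inj) fmodK ?mem_morphim //=.
  rewrite /restrm; apply/eqP/idP=> [/coset_idr-> //|]; last exact: coset_id.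
  exact: (subsetP nDP).
have fmP u v : u \in P -> v \in P -> v * u^-1 \in D ->
  fmod abA (alpha v) = fmod abA (alpha u).
  move=> Pu Pv Dvu; have Pvu : v * u^-1 \in P by rewrite groupM ?groupV.
  rewrite -{1}(mulgKV u v) morphM // fmodM ?mem_morphim //.
  by move: Dvu; rewrite -fmE // => /eqP->; rewrite GRing.add0r.
(* Each orbit of [<[u]>] on the cosets of [P], of length n, contributes a conjugate of [u ^+ n]
   lying in [P]; the lengths sum to |G : P|. *)
have VE u : u \in P -> V u = (fmod abA (alpha u) *+ #|G : P|)%R.
  move=> Pu; have Gu := subsetP sPG u Pu.
  have parH := rcosets_cycle_partition sPG Gu.
  pose X := transversal (rcosets P G :* <[u]>) G.
  have trX : is_transversal X (rcosets P G :* <[u]>) G by apply: transversalP.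
  have sXG := subsetP (transversal_sub trX).
  rewrite /= (transfer_cycle_expansion sPG abA Gu trX).
  rewrite -(sum_index_rcosets_cycle sPG Gu trX) -GRing.sumrMnr.
  apply: eq_bigr => x Xx /=; set n := #|_ : _|.
  have Pun : u ^+ n \in P by rewrite groupX.
  rewrite -fmodX ?mem_morphim // -morphX //.
  have Pc : (u ^+ n) ^ x^-1 \in P.
    have := mulg_exp_card_rcosets P u x; rewrite -/n mem_rcoset.
    by rewrite conjgE invgK mulgA.
  by rewrite /restrm; apply: fmP => //; apply: fusD; rewrite ?groupV ?sXG.
exists ('ker V)%G; split.
- exact: ker_normal.
- apply/setP=> u; rewrite inE; apply/andP/idP=> [[kVu Pu]|Du].
    rewrite -fmE //; have := mker kVu; rewrite VE // => Vu0.
    have co : coprime #|alpha @* P| #|G : P|.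
      rewrite im_alpha; apply: (@pnat_coprime p); first exact: quotient_pgroup.
      by have [] := and3P sylP.
    have := congr1 val Vu0; rewrite fmvalZ fmodK ?mem_morphim //= => au0.
    apply/eqP/val_inj; rewrite fmodK ?mem_morphim //=.
    by apply: (can_in_inj (expgK co)); rewrite ?mem_morphim ?group1 ?expg1n.
  have Pu := subsetP sDP u Du; split=> //.
  apply/kerP; first exact: (subsetP sPG).
  by rewrite VE //; apply/eqP; move: Du; rewrite -fmE // => /eqP->; rewrite GRing.mul0rn.
- rewrite (isog_abelian isoGK); apply/centsP=> a _ b _.
  exact: GRing.addrC.
- by rewrite /= (isog_pgroup p isoGK).
Qed.

(** Transfer with trivial [D]: elements of [P] conjugate in [G] are already conjugate in ['N_G(P)],
    hence equal. *)
Lemma Burnside_complement (gT : finGroupType) (p : nat) (G P : {group gT}) :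
    p.-Sylow(G) P -> 'N_G(P) \subset 'C(P) ->
  exists K : {group gT},
    [/\ K <| G, p^'.-group K, abelian (G / K) & p.-group (G / K)].
Proof.
move=> sylP sNC; have [sPG pP _] := and3P sylP.
have abP : abelian P by apply: subset_trans sNC; rewrite subsetI sPG normG.
have fus : {in P & G, forall u g, u ^ g \in P -> u ^ g * u^-1 \in 1%G}.
  move=> u g Pu Gg Pug; set v := u ^ g in Pug *.
  (* [P] and [P :^ g] are both Sylow in the centralizer of [v]. An element [c] of it that carries
     [P :^ g] to [P] puts [g * c] in the normalizer of [P]. *)
  have sylC (Q : {group gT}) : p.-Sylow(G) Q -> v \in Q -> Q \subset 'C(Q) ->
    p.-Sylow('C_G[v]) Q.
    move=> sylQ Qv abQ; have sQG := pHall_sub sylQ.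
    apply: pHall_subl sylQ; last exact: subsetIl.
    by rewrite subsetI sQG sub_cent1 (subsetP abQ).
  have sylP1 := sylC P sylP Pug abP.
  have sylP2 : p.-Sylow('C_G[v]) (P :^ g).
    apply: sylC; first by rewrite pHallJ.
      by rewrite memJ_conjg.
    by rewrite /= centJ conjSg.
  have [c /setIP[Gc cvc] defP] := Sylow_trans sylP2 sylP1.
  have /(subsetP sNC)/centP cPgc : g * c \in 'N_G(P).
    by rewrite inE groupM //= inE conjsgM -defP.
  have: v ^ c = v by rewrite conjgE -(cent1P cvc) mulKg.
  rewrite -conjgM conjgE -(cPgc u Pu) mulKg => <-.
  by rewrite mulgV group1.
have nsDP : 1%G <| P by apply: normal1.
have [|K [nsKG tiKP abGK pGK]] := transfer_kernel sylP nsDP _ fus.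
  exact: quotient_abelian.
exists K; split=> //.
have := card_Hall (Sylow_setI_normal nsKG sylP).
by rewrite /= tiKP cards1 => /esym/eqP; rewrite partG_eq1.
Qed.

(** * Solubility criteria from the group order *)

Lemma solvable_abelian_quotient (gT : finGroupType) (G K : {group gT}) :
  K <| G -> abelian (G / K) -> solvable G = solvable K.
Proof. by move=> nsKG abGK; rewrite (series_sol nsKG) (abelian_sol abGK) andbT. Qed.

Lemma norm_order2 (gT : finGroupType) (P : {group gT}) :
  #|P| = 2 -> 'N(P) \subset 'C(P).
Proof.
move=> oP; have [x Px ntx] : exists2 x, x \in P & x != 1.
  by apply/trivgPn; rewrite trivg_card1 oP.
have defP : P :=: [set 1; x].
  apply/esym/eqP; rewrite eqEcard cards2 oP eq_sym ntx andbT.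
  by rewrite subUset !sub1set group1.
apply/subsetP=> g nPg; apply/centP=> y; rewrite defP => /set2P[->|->].
  exact: commute1.
apply/commute_sym/commgP/conjg_fixP.
have: x ^ g \in P by rewrite memJ_norm.
by rewrite defP => /set2P[/eqP|//]; rewrite conjg_eq1 (negPf ntx).
Qed.

Lemma size_primes_dvd m n : 0 < n -> m %| n -> size (primes m) <= size (primes n).
Proof.
move=> n_gt0 dvdmn; apply: uniq_leq_size (primes_uniq m) _ => p.
rewrite !mem_primes => /and3P[-> _ dvdpm] /=.
by rewrite n_gt0 (dvdn_trans dvdpm).
Qed.

(** A Sylow 2-subgroup has order 2, so Burnside transfer yields a normal complement; its order
    divides [m], and the p^a q^b theorem applies. *)
Lemma solvable_double_odd (gT : finGroupType) (G : {group gT}) m :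
  #|G| = m.*2 -> odd m -> size (primes m) <= 2 -> solvable G.
Proof.
move=> oG odd_m primes_m; have [P sylP] := Sylow_exists 2 G.
have oP : #|P| = 2.
  rewrite (card_Hall sylP) oG -mul2n partnM ?(odd_gt0 odd_m) // part_pnat_id //.
  by rewrite part_p'nat ?muln1 // -odd_2'nat.
have nCP : 'N_G(P) \subset 'C(P) by rewrite (subset_trans _ (norm_order2 oP)) ?subsetIr.
have [K [nsKG oddK abGK _]] := Burnside_complement sylP nCP.
rewrite (solvable_abelian_quotient nsKG abGK); apply: Burnside_p_a_q_b.
apply: leq_trans primes_m; apply: size_primes_dvd; first exact: odd_gt0.
have: #|K| %| 2 * m by rewrite mul2n -oG cardSg ?normal_sub.
by rewrite Gauss_dvdr // coprimen2 odd_2'nat.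
Qed.

(** The least integer with three distinct prime divisors is 30. *)
Lemma solvable_card_lt30 (gT : finGroupType) (G : {group gT}) :
  #|G| < 30 -> solvable G.
Proof.
move=> ltG; apply: Burnside_p_a_q_b.
have /allP-> // : all (fun n => size (primes n) <= 2) (iota 0 30) by [].
by rewrite mem_iota.
Qed.

(* The products with three prime divisors are 30 and 42, which are twice odd. *)
Lemma solvable_card_mul9 (gT : finGroupType) (G : {group gT}) m n :
  #|G| = (m * n)%N -> m <= 9 -> n <= 9 -> solvable G.
Proof.
move=> oG le_m9 le_n9.
have: all (fun m => all (fun n => (size (primes (m * n)%N) <= 2) ||
    [&& ~~ odd (m * n)%N, odd (m * n)%N./2 & size (primes (m * n)%N./2) <= 2])
  (iota 0 10)) (iota 0 10) by [].
move/allP/(_ m); rewrite mem_iota => /(_ le_m9)/allP/(_ n).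
rewrite mem_iota => /(_ le_n9); rewrite -oG => /orP[|/and3P[evG oddG2]].
  exact: Burnside_p_a_q_b.
by apply: solvable_double_odd; rewrite // even_halfK.
Qed.

(** * Small solubilizers *)

Lemma solvable_joing (gT : finGroupType) (A B : {group gT}) :
  B \subset 'N(A) -> solvable A -> solvable B -> solvable (A <*> B).
Proof.
move=> nAB solA solB; have nsA : A <| A <*> B by rewrite normalYl.
by rewrite (series_sol nsA) solA quotientYidl // quotient_sol.
Qed.

Lemma solvable_sub_solubilizer (gT : finGroupType) (G H : {group gT}) x :
  H \subset G -> x \in H -> solvable H -> H \subset solubilizer G x.
Proof.
move=> sHG Hx solH; apply/subsetP=> y Hy; rewrite inE (subsetP sHG) //=.
by apply: solvableS solH; rewrite gen_subG subUset !sub1set Hx.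
Qed.

Lemma solubilizerS (gT : finGroupType) (G H : {group gT}) x :
  H \subset G -> solubilizer H x \subset solubilizer G x.
Proof. by move/subsetP=> sHG; apply/subsetP=> y /[!inE] /andP[/sHG->]. Qed.

Lemma cent1_sub_solubilizer (gT : finGroupType) (G : {group gT}) x :
  'C_G[x] \subset solubilizer G x.
Proof.
apply/subsetP=> y /setIP[Gy cxy]; rewrite inE Gy /=; apply: abelian_sol.
rewrite abelian_gen abelianE; apply/subsetP=> u /set2P[]->; apply/centP=> v /set2P[]-> //.
  by apply: commute_sym; apply/cent1P.
exact/cent1P.
Qed.

(** Equality of the squares says exactly that [x] inverts c = x y^-1, so <c><x> is metacyclic; it
    contains y = c^-1 x. *)
Lemma solvable_inverted_gen (gT : finGroupType) (x y : gT) :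
  x ^+ 2 = y ^+ 2 -> solvable <<[set x; y]>>.
Proof.
move=> exy; pose c := x * y^-1.
have cx : c ^ x = c^-1.
  rewrite conjgE /c !mulgA mulVg mul1g invMg invgK.
  by apply: (mulgI y); apply: (mulIg x); rewrite !mulgA mulgV mul1g mulgKV.
have nxc : <[x]> \subset 'N(<[c]>).
  by rewrite norms_cycle cx groupV cycle_id.
apply: solvableS (solvable_joing nxc (abelian_sol (cycle_abelian _))
  (abelian_sol (cycle_abelian _))).
rewrite gen_subG subUset !sub1set mem_gen ?inE ?cycle_id ?orbT //=.
rewrite -[y]invgK -(mulKg x y^-1) groupV groupM //.
  by rewrite groupV mem_gen // inE cycle_id orbT.
by rewrite mem_gen // inE cycle_id.
Qed.

(** Besides settling [x ^+ 2 = 1], this serves inside the centralizer of [x ^+ 2] when [x] has order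
    4 or 6. *)
Lemma solvable_of_central_sqr (gT : finGroupType) (G : {group gT}) x :
  x \in G -> x ^+ 2 \in 'C(G) -> #|solubilizer G x| <= 9 -> solvable G.
Proof.
move=> Gx cGx2 small.
have leC : #|'C_G[x]| <= 9.
  exact: leq_trans (subset_leq_card (cent1_sub_solubilizer G x)) small.
have leX : #|x ^: G| <= 9.
  apply: leq_trans small; apply: subset_leq_card; apply/subsetP=> _ /imsetP[g Gg ->].
  rewrite inE groupJ //=; apply: solvable_inverted_gen.
  by rewrite -conjXg conjgE (centP cGx2 g Gg) mulKg.
by apply: solvable_card_mul9 leC leX; rewrite -index_cent1 Lagrange ?subsetIl.
Qed.

Section SmallSolubilizer.

Variables (gT : finGroupType) (G : {group gT}) (x : gT).
Hypothesis (small : #|solubilizer G x| <= 9).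

Lemma card_solvable_le9 (H : {group gT}) :
  H \subset G -> x \in H -> solvable H -> #|H| <= 9.
Proof.
move=> sHG Hx solH; apply: leq_trans small; apply: subset_leq_card.
exact: solvable_sub_solubilizer.
Qed.

(** For each prime p dividing |K| there is an [A]-invariant Sylow p-subgroup [P] of [K]. Then PA is
    soluble and contains [x], so |P||A| is at most 9 and p is 2 or 3. *)
Lemma solvable_coprime_action (A K : {group gT}) :
    A \subset G -> K \subset G -> x \in A -> 1 < #|A| -> solvable A ->
    A \subset 'N(K) -> coprime #|K| #|A| ->
  solvable K.
Proof.
move=> sAG sKG Ax A_gt1 solA nKA coKA; apply: Burnside_p_a_q_b.
apply: (@uniq_leq_size _ _ [:: 2; 3]); first exact: primes_uniq.
move=> p; rewrite mem_primes => /and3P[pr_p _ p_dv_K].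
have [P sylP nPA] := sol_coprime_Sylow_exists p solA nKA coKA.
have [sPK pP _] := and3P sylP.
have coPA : coprime #|P| #|A| by apply: coprimeSg coKA.
have: #|P <*> A| <= 9.
  apply: card_solvable_le9; first by rewrite join_subG sAG (subset_trans sPK).
    by rewrite (subsetP (joing_subr _ _)).
  exact: solvable_joing (pgroup_sol pP) solA.
rewrite /= norm_joinEr // coprime_cardMg // => lePA.
have : p <= #|P|.
  have p_dv_P : p %| #|P|.
    by rewrite (card_Hall sylP) p_part -{1}(expn1 p) dvdn_exp2l //
      logn_gt0 mem_primes pr_p cardG_gt0.
  by rewrite dvdn_leq.
move=> lepP; have: p * 2 <= 9 by apply: leq_trans lePA; apply: leq_mul.
by case: p pr_p {p_dv_K sylP pP lepP} => [|[|[|[|[|n]]]]].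
Qed.

Lemma solvable_Sylow_norm_cent (p : nat) (P : {group gT}) :
  p.-Sylow(G) P -> x \in P -> 1 < #|P| -> 'N_G(P) \subset 'C(P) -> solvable G.
Proof.
move=> sylP Px P_gt1 nCP; have [sPG pP _] := and3P sylP.
have [K [nsKG p'K abGK _]] := Burnside_complement sylP nCP.
rewrite (solvable_abelian_quotient nsKG abGK).
apply: solvable_coprime_action Px P_gt1 (pgroup_sol pP) _ _ => //.
- exact: normal_sub.
- by rewrite (subset_trans sPG) ?normal_norm.
- by rewrite coprime_sym (pnat_coprime pP).
Qed.

End SmallSolubilizer.

(** * Sylow subgroups of order at least four *)

(** For y normalizing [P], the group P<y> is soluble, so its order is at most 9. As |P| is at least
    4, the index of [P] in it is at most 2, and index 2 would force |P| = 4, although the index is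
    prime to p. *)
Lemma norm_Sylow_small_solubilizer (gT : finGroupType) (p : nat)
    (G P : {group gT}) x :
    #|solubilizer G x| <= 9 -> p.-Sylow(G) P -> x \in P -> 4 <= #|P| ->
  'N_G(P) = P.
Proof.
move=> small sylP Px P_ge4; have [sPG pP p'iGP] := and3P sylP.
apply/eqP; rewrite eqEsubset andbC subsetI sPG normG /=.
apply/subsetP=> y /setIP[Gy nPy]; pose H := P <*> <[y]>.
have sHG : H \subset G by rewrite join_subG sPG cycle_subG.
have sPH : P \subset H := joing_subl _ _.
have solH : solvable H.
  by rewrite solvable_joing ?cycle_subG ?(pgroup_sol pP) ?abelian_sol ?cycle_abelian.
have := card_solvable_le9 small sHG (subsetP sPH x Px) solH.
have p'iHP : p^'.-nat #|H : P| := pnat_dvd (indexSg sPH sHG) p'iGP.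
rewrite -(Lagrange sPH) => leH.
have [iHP1 | iHP_gt1] := leqP #|H : P| 1.
  have /(index1g sPH)-> : #|H : P| = 1%N by apply/eqP; rewrite eqn_leq iHP1 indexg_gt0.
  by rewrite mem_gen // inE cycle_id orbT.
have iHP2 : #|H : P| = 2.
  apply/eqP; rewrite eqn_leq iHP_gt1 andbT leqNgt; apply/negP=> iHP_gt2.
  by have := leq_trans (leq_mul P_ge4 iHP_gt2) leH.
have oP : #|P| = 4.
  apply/eqP; rewrite eqn_leq P_ge4 andbT leqNgt; apply/negP=> P_gt4.
  by have := leq_trans (leq_mul P_gt4 iHP_gt1) leH.
move: p'iHP pP; rewrite /pgroup oP iHP2 /= => p'2 p4.
have /(pnat_coprime p4) : p^'.-nat 2 by [].
by [].
Qed.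

Lemma solvable_abelian_Sylow (gT : finGroupType) (p : nat)
    (G P : {group gT}) x :
    #|solubilizer G x| <= 9 -> p.-Sylow(G) P -> x \in P -> 4 <= #|P| ->
    abelian P -> solvable G.
Proof.
move=> small sylP Px P_ge4 abP.
apply: (solvable_Sylow_norm_cent small sylP Px).
- exact: leq_trans P_ge4.
- by rewrite (norm_Sylow_small_solubilizer small sylP Px).
Qed.

Lemma cycle4P (gT : finGroupType) (x u : gT) :
  #[x] = 4 -> u \in <[x]> -> [\/ u = 1, u = x, u = x ^+ 2 | u = x^-1].
Proof.
move=> ox; rewrite -[<[x]>]/(gval _) => /cyclePmin[i]; rewrite ox.
case: i => [|[|[|[|//]]]] _ ->; [exact: Or41 | exact: Or42 | exact: Or43 |].
by apply: Or44; apply: (mulgI x); rewrite -expgS -ox expg_order mulgV.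
Qed.

(** * Sylow 2-subgroups of order eight containing an element of order four *)

Section SylowOrder8.

Variables (gT : finGroupType) (G P : {group gT}) (x : gT).
Hypotheses (small : #|solubilizer G x| <= 9) (sylP : 2.-Sylow(G) P).
Hypotheses (Px : x \in P) (oP : #|P| = 8) (ox : #[x] = 4).

Let D := <[x]>%G.
Let z := x ^+ 2.
Let sPG : P \subset G := pHall_sub sylP.
Let Gx : x \in G := subsetP sPG x Px.
Let Dz : z \in D. Proof. exact: mem_cycle. Qed.
Let oz : #[z] = 2. Proof. by rewrite orderXdiv ox. Qed.
Let Pz : z \in P. Proof. exact: groupX. Qed.

Let sDP : D \subset P. Proof. by rewrite cycle_subG. Qed.
Let iPD : #|P : D| = 2.
Proof. by rewrite -divgS // oP -orderE ox. Qed.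
Let nsDP : D <| P. Proof. exact: index2_normal. Qed.

Let solvable_over_P (H : {group gT}) :
  P \subset H -> H \subset G -> solvable H -> H :=: P.
Proof.
move=> sPH sHG solH; apply/eqP; rewrite eq_sym eqEcard sPH oP.
have := card_solvable_le9 small sHG (subsetP sPH x Px) solH.
have : 8 %| #|H| by rewrite -oP cardSg.
by case/dvdnP=> [[|[|k]] ->].
Qed.

(** [<[z]>] is characteristic in the normal subgroup [D], so [P] centralizes [z]. In the centralizer
    of [z] the square of [x] is central, so this centralizer is soluble and cannot exceed [P]. *)
Lemma cent1_sqr_Sylow8 : 'C_G[z] = P.
Proof.
have sPC : P \subset 'C_G[z].
  rewrite subsetI sPG -cent_cycle; apply: subset_trans (norm_order2 oz).
  apply: char_norm_trans (normal_norm nsDP).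
  by rewrite sub_cyclic_char ?cycle_cyclic // cycle_subG.
have Cx := subsetP sPC x Px.
have solC : solvable 'C_G[z].
  apply: (solvable_of_central_sqr Cx).
    by rewrite -sub1set centsC (subset_trans (subsetIr _ _)) // cent_set1.
  by apply: leq_trans small; rewrite subset_leq_card // solubilizerS ?subsetIl.
by rewrite -(solvable_over_P sPC) ?subsetIl.
Qed.

Let sqrD v : v \in P -> v ^+ 2 \in D.
Proof.
move=> Pv; apply: coset_idr; first by rewrite groupX // (subsetP (normal_norm nsDP)).
rewrite morphX ?(subsetP (normal_norm nsDP)) //.
apply/eqP; rewrite -order_dvdn -iPD -card_quotient ?normal_norm //.
by rewrite order_dvdG // mem_quotient.
Qed.

Lemma no_fusion_sqr_Sylow8 g : g \in G -> z ^ g \in P -> z ^ g \in D.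
Proof.
move=> Gg Pv; apply/idPn=> notDv; set v := z ^ g in Pv notDv.
have CzP := cent1_sqr_Sylow8.
have CvP : 'C_G[v] = P :^ g by rewrite cent1J -(conjGid Gg) -conjIg CzP.
have ov : #[v] = 2 by rewrite orderJ.
(* V is normal in both P and P :^ g, and its normalizer is soluble, hence is P. *)
pose V := <[z]> <*> <[v]>.
have cvz : v \in 'C[z] by move: Pv; rewrite -CzP => /setIP[].
have sVC u : u \in [set z; v] -> V \subset 'C_G[u].
  have czv : z \in 'C[v] by rewrite cent1C.
  by case/set2P=> ->; rewrite join_subG !cycle_subG !in_setI !(subsetP sPG) //
    !cent1id ?cvz ?czv.
have sVP : V \subset P by rewrite -CzP sVC ?set21.
have sVPg : V \subset P :^ g by rewrite -CvP sVC ?set22.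
have oV : #|V| = 4.
  rewrite /V joingC norm_joinEl; last by rewrite cents_norm // cent_cycle cycle_subG.
  rewrite TI_cardMg -?orderE ?ov ?oz //; apply: prime_TIg; rewrite -?orderE ?ov //.
  by rewrite cycle_subG; apply: contra notDv; apply: subsetP; rewrite cycle_subG.
have nVP : P \subset 'N(V).
  by apply: normal_norm; apply: index2_normal; rewrite // -divgS // oP oV.
have nVPg : P :^ g \subset 'N(V).
  by apply: normal_norm; apply: index2_normal; rewrite // -divgS // cardJg oP oV.
have sPN : P \subset 'N_G(V) by rewrite subsetI sPG.
(* The order is at most 8 * 3 = 24: the centralizer of [z] is [P], and the conjugates of [z] here
   are nontrivial elements of [V]. *)
have solN : solvable 'N_G(V).
  apply: solvable_card_lt30; rewrite -(Lagrange (subsetIl _ 'C[z])) index_cent1.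
  have leC8 : #|'N_G(V) :&: 'C[z]| <= 8.
    by rewrite -oP -CzP subset_leq_card // setSI ?subsetIl.
  have leX3 : #|z ^: 'N_G(V)| <= 3.
    have /eq_leq : #|V :\ 1| = 3 by have := cardsD1 1 V; rewrite oV group1 => -[].
    apply: leq_trans; apply: subset_leq_card; apply/subsetP=> _ /imsetP[h Nh ->].
    have [_ nVh] := setIP Nh; rewrite in_setD1 conjg_eq1 -order_eq1 oz memJ_norm //=.
    by rewrite mem_gen // inE cycle_id.
  by apply: leq_ltn_trans (leq_mul leC8 leX3) _.
have eqNP : 'N_G(V) = P by apply: (solvable_over_P sPN (subsetIl _ _) solN).
(* Now [P :^ g] lies in ['N_G(V)] = [P], so [g] normalizes the self-normalizing group [P]. *)
have Pg : g \in P.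
  have sPgP : P :^ g \subset P by rewrite -{2}eqNP subsetI conj_subG.
  by rewrite -(norm_Sylow_small_solubilizer small sylP Px) ?oP // inE Gg inE.
by case/negP: notDv; rewrite memJ_norm // (subsetP (normal_norm nsDP)).
Qed.

(** It suffices that no element of [D] fuses in [P] to one outside [D]: as [D] has index 2, [u] and
    [u ^ g] then lie in the same coset. *)
Lemma fusion_Sylow8 :
  {in P & G, forall u g, u ^ g \in P -> u ^ g * u^-1 \in D}.
Proof.
have sub_fus u g : u \in D -> g \in G -> u ^ g \in P -> u ^ g \in D.
  move=> Du Gg Pv; have Pu := subsetP sDP u Du.
  (* For [u] of order 4, [z ^ g] is an involution of [D], hence [z] itself; so [g] centralizes [z],
     lies in [P], and normalizes [D]. *)
  have fus4 : u ^+ 2 = z -> u ^ g \in D.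
    move=> defz; have Dzg : z ^ g \in D by rewrite -defz conjXg sqrD.
    have ozg : #[z ^ g] = 2 by rewrite orderJ.
    suffices Pg : g \in P by rewrite memJ_norm // (subsetP (normal_norm nsDP)).
    rewrite -cent1_sqr_Sylow8 inE Gg; apply/cent1P/commute_sym/commgP/conjg_fixP.
    case: (cycle4P ox Dzg) => // defzg.
    - by rewrite defzg order1 in ozg.
    - by rewrite defzg ox in ozg.
    by rewrite defzg orderV ox in ozg.
  case: (cycle4P ox Du) => defu.
  - by rewrite defu conj1g.
  - by apply: fus4; rewrite defu.
  - by rewrite defu in Pv *; apply: no_fusion_sqr_Sylow8.
  apply: fus4; rewrite defu expgVn.
  by apply: (mulgI z); rewrite mulgV -expgD -[(2 + 2)%N]ox expg_order.
move=> u g Pu Gg Pv.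
have eqD : (u ^ g \in D) = (u \in D).
  apply/idP/idP=> [Dv|Du]; last exact: sub_fus.
  by rewrite -(conjgK g u) sub_fus ?groupV ?conjgK.
have [Du|notDu] := boolP (u \in D); first by rewrite groupM ?groupV ?eqD.
have: D :* u = D :* (u ^ g).
  by rewrite !(rcoset_index2 sDP iPD) // inE ?eqD ?notDu.
by move/esym/rcoset_eqP; rewrite mem_rcoset.
Qed.

(** The transfer kernel has the cyclic group [D] of order 4 as a Sylow 2-subgroup, which returns to
    the abelian case. *)
Lemma solvable_Sylow8 : solvable G.
Proof.
have [|K [nsKG defD abGK _]] := transfer_kernel sylP nsDP _ fusion_Sylow8.
  by rewrite cyclic_abelian // prime_cyclic // card_quotient ?normal_norm ?iPD.
rewrite (solvable_abelian_quotient nsKG abGK).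
have sylD : 2.-Sylow(K) D by rewrite -[gval D]defD (Sylow_setI_normal nsKG).
apply: (solvable_abelian_Sylow _ sylD (cycle_id x)); rewrite -?orderE ?ox //.
  by apply: leq_trans small; rewrite subset_leq_card // solubilizerS ?normal_sub.
exact: cycle_abelian.
Qed.

End SylowOrder8.

(** * Self-centralizing elements of order three *)

Lemma exists_summand_gt0 (I : finType) (P : pred I) (f : I -> nat) :
  0 < \sum_(i | P i) f i -> exists2 i, P i & 0 < f i.
Proof.
rewrite lt0n sum_nat_eq0 negb_forall => /existsP[i].
by rewrite negb_imply -lt0n => /andP[]; exists i.
Qed.

Lemma order3_inv_neq (gT : finGroupType) (x : gT) : #[x] = 3 -> x^-1 != x.
Proof.
move=> ox; apply/eqP=> eqVx; have: 3 %| 2; last by [].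
by rewrite -ox order_dvdn expgS -{1}eqVx mulVg.
Qed.

Lemma cycle3E (gT : finGroupType) (x : gT) :
  #[x] = 3 -> <[x]> = [set 1; x; x^-1].
Proof.
move=> ox; have ntx : x != 1 by rewrite -order_eq1 ox.
have nVx := order3_inv_neq ox.
apply/esym/eqP; rewrite eqEcard !subUset !sub1set group1 groupV cycle_id /= -orderE ox.
by rewrite setUC cardsU1 cards2 !inE negb_or (eq_sym 1) ntx nVx invg_eq1 ntx.
Qed.

(** * Character values and a class structure constant at an element of order three *)

Section CharacterArithmetic.

Import GRing.Theory Num.Theory Order.TTheory.
Local Open Scope ring_scope.

(* Exactly two further e i are nonzero; they have opposite signs, and their d i
are consecutive integers. *)
Lemma one_le_sum_cube_quotients (F : numFieldType) (I : finType) (i0 : I)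
    (e : I -> int) (d : I -> nat) :
    e i0 = 1 -> d i0 = 1%N -> (forall i, (0 < d i)%N) ->
    \sum_i e i ^+ 2 = 3 -> \sum_i e i * (d i)%:Z = 0 ->
  1 <= \sum_i (e i)%:~R ^+ 3 / (d i)%:R :> F.
Proof.
move=> e0 d0 d_gt0 sum_e2 sum_ed.
pose f i := (`|e i| * `|e i|)%N.
have fE i : (f i)%:Z = e i ^+ 2 by rewrite /f PoszM !abszE -expr2 real_normK ?num_real.
have sum_f : (\sum_i f i = 3)%N.
  apply/eqP; rewrite -eqz_nat (big_morph Posz PoszD (erefl _)).
  by apply/eqP/(etrans _ sum_e2)/eq_bigr => i _; rewrite fE.
have sum_f0 : (\sum_(i | i != i0) f i = 2)%N.
  by move: sum_f; rewrite (bigD1 i0) //= {1}/f e0 => -[].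
have [|i1 ni10 f1_gt0] := @exists_summand_gt0 _ (fun i => i != i0) f.
  by rewrite sum_f0.
(* A positive square that is at most 2 equals 1. *)
have [f1 sum_f1] : f i1 = 1%N /\ (\sum_(i | (i != i0) && (i != i1)) f i = 1)%N.
  move: sum_f0 f1_gt0; rewrite (bigD1 i1) //= /f.
  by case: `|e i1|%N => [|[|[|k]]] //= -[].
have [|i2 /andP[ni20 ni21] f2_gt0] :=
    @exists_summand_gt0 _ (fun i => (i != i0) && (i != i1)) f.
  by rewrite sum_f1.
move: sum_f1; rewrite (bigD1 i2) ?ni20 //= => sum_f2.
have f2 : f i2 = 1%N by case: (f i2) f2_gt0 sum_f2 => [|[|k]].
have f_eq0 i : [&& i != i0, i != i1 & i != i2] -> e i = 0.
  rewrite andbA => ni; move/eqP: sum_f2; rewrite f2 -[X in _ == X]addn0 eqn_add2l.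
  rewrite sum_nat_eq0 => /forallP/(_ i); rewrite ni /= muln_eq0 orbb.
  by rewrite absz_eq0 => /eqP.
have sumE (V : zmodType) (g : I -> V) : (forall i, e i = 0 -> g i = 0) ->
    \sum_i g i = g i0 + (g i1 + g i2).
  move=> g_eq0; rewrite (bigD1 i0) // (bigD1 i1) // (bigD1 i2) ?ni20 //=.
  by rewrite big1 ?addr0 // => i; rewrite -andbA => ni; rewrite g_eq0 // f_eq0.
move: sum_ed; rewrite !sumE => [|i ->|i ->]; last by rewrite mul0r.
  rewrite e0 d0; move: (d_gt0 i1) (d_gt0 i2).
  have sgnE i : f i = 1%N -> e i = 1 \/ e i = -1.
    rewrite /f; case: (e i) => [[|[|n]]|[|n]] //; [by left | by right].
  have le_quot (m n : nat) : (0 < m)%N -> (n = m.+1)%N ->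
    1 <= 1 + (m%:R^-1 - n%:R^-1) :> F.
    move=> m_gt0 ->; rewrite lerDl subr_ge0 lef_pV2 ?posrE ?ltr0n // ler_nat.
    exact: leqnSn.
  have cubeN1 : (-1)%:~R ^+ 3 = -1 :> F by rewrite rmorphN1 -signr_odd expr1.
  (* Equal signs contradict 1 + e1 d1 + e2 d2 = 0 with positive degrees. Otherwise the smaller
     degree carries the sign +1, and the sum is 1 + 1/m - 1/(m+1). *)
  case: (sgnE i1 f1) (sgnE i2 f2) => -> [] ->; rewrite ?cubeN1 ?expr1n ?mulN1r ?mul1r invr1.
  - lia.
  - by move=> ? ? ?; apply: le_quot; lia.
  - by move=> ? ? ?; rewrite [- _ + _]addrC; apply: le_quot; lia.
  - lia.
by rewrite expr0n mul0r.
Qed.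

(** The multiplicity of the trivial character in the restriction to [<[x]>] is (chi(1) + 2 chi(x)) /
    3. Hence chi(x) is rational, and it is an algebraic integer. *)
Lemma irr_order3_int (gT : finGroupType) (G : {group gT}) x (i : Iirr G) :
  x \in G -> #[x]%g = 3%N -> x^-1%g \in (x ^: G)%g -> 'chi_i x \is a Num.int.
Proof.
move=> Gx ox xGV; apply: Cint_rat_Aint; last by rewrite Aint_irr.
have chiV : 'chi_i x^-1%g = 'chi_i x by have /imsetP[y Gy ->] := xGV; rewrite cfunJ.
have ntx : x != 1%g by rewrite -order_eq1 ox.
have nVx := order3_inv_neq ox.
have sXG : <[x]>%g \subset G by rewrite cycle_subG.
have := Cnat_cfdot_char (cfRes_char <[x]> (irr_char i)) (cfun1_char <[x]>).
rewrite cfdotE -orderE ox (eq_bigr 'chi_i) => [|y Xy]; last first.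
  by rewrite cfResE // cfun1E Xy conjC1 mulr1.
have -> : \sum_(y in <[x]>%g) 'chi_i y = 'chi_i 1%g + 'chi_i x + 'chi_i x.
  rewrite cycle3E // setUC big_setU1 ?big_setU1 ?big_set1 //= ?chiV 1?addrC //.
    by rewrite inE eq_sym.
  by rewrite !inE invg_eq1 negb_or ntx nVx.
set m := _ * _ => nat_m.
have -> : 'chi_i x = (3 * m - 'chi_i 1%g) / 2 by rewrite /m; field.
apply: rpred_div; last exact: rpred_nat.
apply: rpredB; last exact/rpred_nat_num/Cnat_irr1.
by apply: rpredM; [apply: rpred_nat | apply: rpred_nat_num].
Qed.

(** The number N of factorizations of [x] into two of its conjugates is c^2 / |G| times the
    character sum S, where c is the class size. As |G| = 3c, this reads c S = 3 N; with S at least 1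
    and N at most 1, c is at most 3. *)
Lemma card_le9_self_centralizing3 (gT : finGroupType) (G : {group gT}) x :
    x \in G -> #[x]%g = 3%N -> #|'C_G[x]%g| = 3%N -> x^-1%g \in (x ^: G)%g ->
    (forall a b, a \in (x ^: G)%g -> b \in (x ^: G)%g -> (a * b)%g = x ->
      a = x^-1%g) ->
  (#|G| <= 9)%N.
Proof.
move=> Gx ox oC xGV uniq_ab.
pose k := enum_rank_in (classes1 G) (x ^: G)%g.
have defk : enum_val k = (x ^: G)%g by rewrite enum_rankK_in ?mem_classes.
have kx : x \in enum_val k by rewrite defk class_refl.
have := gring_classM_coef_sum_eq kx kx kx; rewrite (set_gring_classM_coef _ _ kx) defk.
set N := #|_|; set S := \sum_i _ => defN.
have leN1 : (N <= 1)%N.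
  rewrite -(cards1 (x^-1%g, (x * x)%g)); apply/subset_leq_card/subsetP=> -[a b].
  rewrite !inE /= => /andP[/andP[xGa xGb] /eqP def_ab].
  have defa := uniq_ab a b xGa xGb def_ab.
  by rewrite -[b](mulKg a) def_ab defa invgK.
have chi_int i : 'chi[G]_i x \is a Num.int by apply: irr_order3_int.
pose e (i : Iirr G) := Num.floor ('chi_i x).
pose d (i : Iirr G) := irr_degree (socle_of_Iirr i).
have eE i : (e i)%:~R = 'chi_i x by apply: floorK.
have conj_chi i : ('chi[G]_i x)^* = 'chi_i x by rewrite conj_Creal // Rreal_int.
have S_ge1 : 1 <= S.
  have -> : S = \sum_i (e i)%:~R ^+ 3 / (d i)%:R.
    apply: eq_bigr => i _; rewrite eE conj_chi irr1_degree.
    by rewrite !exprS expr0 mulr1 mulrA.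
  (* The two sum conditions are column orthogonality: the column of [x] with itself gives |C_G(x)| =
     3, and with the column of 1 gives 0. *)
  apply: (@one_le_sum_cube_quotients _ _ 0).
  - by apply: (@intr_inj algC); rewrite eE irr0 cfun1E Gx.
  - apply/eqP; rewrite -(eqr_nat algC); apply/eqP.
    by rewrite /d -irr1_degree irr0 cfun11.
  - by move=> i; rewrite irr_degree_gt0.
  - apply: (@intr_inj algC); rewrite rmorph_sum /=.
    have := second_orthogonality_relation x Gx;
    rewrite class_refl oC /= mulr1n rmorph_nat => <-.
    by apply: eq_bigr => i _; rewrite rmorphXn /= eE conj_chi.
  apply: (@intr_inj algC); rewrite rmorph_sum /=.
  have := second_orthogonality_relation x (group1 G).
  rewrite class1G inE -order_eq1 ox /= mulr0n rmorph0 => sum0; rewrite -[RHS]sum0.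
  apply: eq_bigr => i _; rewrite rmorphM /= eE irr1_degree conjC_nat.
  by rewrite -pmulrn.
have oG : (#|G| = 3 * #|x ^: G|%g)%N.
  by rewrite -index_cent1 -oC Lagrange // subsetIl.
have c_gt0 : (0 < #|x ^: G|%g)%N by apply/card_gt0P; exists x; apply: class_refl.
move: (#|_|%g) c_gt0 oG defN => c c_gt0 -> defN.
rewrite -[9%N]/(3 * 3)%N leq_pmul2l // -(ler_nat algC).
have cS : c%:R * S = 3 * N%:R.
  by rewrite defN !natrM; field; rewrite pnatr_eq0 -lt0n.
apply: le_trans (_ : c%:R * S <= _); first by rewrite ler_peMr ?ler0n.
by rewrite cS -natrM ler_nat -[3%N in leqRHS]muln1 leq_pmul2l.
Qed.

End CharacterArithmetic.

(* The conjugates of [a * b^-1] under [<[a]>] commute. *)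
Lemma solvable_triangle333 (gT : finGroupType) (a b : gT) :
  a ^+ 3 = 1 -> b ^+ 3 = 1 -> (a * b) ^+ 3 = 1 -> solvable <<[set a; b]>>.
Proof.
move=> a3 b3 ab3.
have aV : a^-1 = a * a by apply: (mulgI a); rewrite mulgV -a3 !expgS expg0 mulg1.
have bV : b^-1 = b * b by apply: (mulgI b); rewrite mulgV -b3 !expgS expg0 mulg1.
(* This is (ab)^3 = 1 in the form (aba)(bab) = 1. *)
have aba : a * b * a = b^-1 * a^-1 * b^-1.
  apply: (mulIg (b * a * b)); rewrite -!mulgA !mulKg mulVg.
  by rewrite -ab3 !expgS expg0 mulg1 !mulgA.
pose u0 := a * b^-1; pose u1 := u0 ^ a; pose u2 := u1 ^ a.
have u2a : u2 ^ a = u0 by rewrite -!conjgM -?mulgA -aV mulgV conjg1.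
have u1E : u1 = b^-1 * a by rewrite /u1 conjgE mulgA mulKg.
(* Both products equal aba: u0 u1 = a b^-2 a and u1 u0 = b^-1 a^2 b^-1. *)
have c01 : commute u0 u1.
  have bVV : b^-1 * b^-1 = b by rewrite -invMg -bV invgK.
  rewrite /commute u1E /u0 mulgA -(mulgA a) bVV aba.
  by rewrite !mulgA -(mulgA _ a a) -aV.
have c12 : commute u1 u2 by rewrite /commute -!conjMg c01.
have c20 : commute u2 u0 by rewrite -u2a /commute -(conjMg u1 u2) -(conjMg u2 u1) c12.
pose A := <<[set u0; u1; u2]>>.
have abA : abelian A.
  rewrite abelian_gen abelianE; apply/subsetP=> u Au; apply/centP=> v; move: Au.
  by rewrite !inE => /orP[/orP[]|] /eqP-> /orP[/orP[]|] /eqP->.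
have nAa : <[a]> \subset 'N(A).
  rewrite cycle_subG inE -genJ genS //; apply/subsetP=> _ /imsetP[u Au ->].
  move: Au; rewrite !inE => /orP[/orP[]|] /eqP->; rewrite ?u2a ?eqxx ?orbT //.
have := solvable_joing nAa (abelian_sol abA) (abelian_sol (cycle_abelian a)).
apply: solvableS; rewrite gen_subG subUset !sub1set.
have Ha : a \in A <*> <[a]> by rewrite mem_gen // inE cycle_id orbT.
rewrite Ha /= -groupV -(mulKg a b^-1) groupM ?groupV //.
by rewrite mem_gen // inE mem_gen // !inE eqxx.
Qed.

(** If the normalizer of [P] centralizes [P], Burnside transfer applies. Otherwise [x] is inverted
    in [G], and the character bound finishes once its hypotheses are checked. *)
Lemma solvable_Sylow3 (gT : finGroupType) (G : {group gT}) x :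
    #|solubilizer G x| <= 9 -> #[x] = 3 -> 3.-Sylow(G) <[x]> -> solvable G.
Proof.
move=> small ox sylP; pose P := <[x]>%G.
have sPG : P \subset G := pHall_sub sylP.
have Gx : x \in G by rewrite -cycle_subG.
have [nCP|] := boolP ('N_G(P) \subset 'C(P)).
  by apply: (solvable_Sylow_norm_cent small sylP (cycle_id x)); rewrite // -orderE ox.
case/subsetPn=> y /setIP[Gy nPy]; rewrite cent_cycle => not_cxy.
have ord3 u : u \in P -> u != 1 -> (u == x) || (u == x^-1).
  by rewrite /= cycle3E // !inE -orbA => /orP[/eqP->/eqP|].
have ntx : x != 1 by rewrite -order_eq1 ox.
have xy : x ^ y = x^-1.
  have: x ^ y \in P by rewrite memJ_norm ?cycle_id.
  move/ord3; rewrite conjg_eq1 => /(_ ntx)/orP[/eqP xy|/eqP//].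
  by case/negP: not_cxy; apply/cent1P/commute_sym/commgP/conjg_fixP.
have xGV : x^-1 \in x ^: G by rewrite -xy memJ_class.
have nPC : 'C_G[x] \subset 'N_G(P) by rewrite setIS // -cent_cycle cent_sub.
have cNx : 'C_('N_G(P))[x] = 'C_G[x].
  by rewrite setIAC; apply/setIidPl; apply: subset_trans nPC (subsetIr _ _).
have ixN : #|x ^: 'N_G(P)| = 2.
  apply/eqP; rewrite eqn_leq; apply/andP; split.
    apply: leq_trans (_ : #|[set x; x^-1]| <= 2); last by rewrite cards2; case: (_ != _).
    apply/subset_leq_card/subsetP=> _ /imsetP[h /setIP[_ nPh] ->].
    by rewrite !inE ord3 ?conjg_eq1 // memJ_norm ?cycle_id.
  apply: leq_trans (_ : #|[set x; x^-1]| <= _).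
    by rewrite cards2 eq_sym order3_inv_neq.
  apply: subset_leq_card; rewrite subUset !sub1set class_refl -xy memJ_class //.
  by rewrite inE Gy.
have leC : #|'C_G[x]| <= 9.
  exact: leq_trans (subset_leq_card (cent1_sub_solubilizer G x)) small.
have oN : #|'N_G(P)| = (#|'C_G[x]| * 2)%N.
  by rewrite -ixN -index_cent1 cNx Lagrange.
have solN : solvable 'N_G(P).
  by apply: solvable_card_lt30; rewrite oN (leq_ltn_trans (leq_mul leC (leqnn 2))).
have Nx : x \in 'N_G(P) by apply: (subsetP nPC); rewrite inE Gx cent1id.
have leN := card_solvable_le9 small (subsetIl _ _) Nx solN.
(* The order is a multiple of 3 whose double is at most 9. *)
have oC : #|'C_G[x]| = 3.
  have: 3 %| #|'C_G[x]| by rewrite -ox order_dvdG // inE Gx cent1id.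
  case/dvdnP=> k oC; move: leN (cardG_gt0 'C_G[x]); rewrite oN /= oC.
  by case: k {oC} => [|[|k]].
suffices leG9 : #|G| <= 9 by apply/solvable_card_lt30/(leq_ltn_trans leG9).
apply: (card_le9_self_centralizing3 Gx ox oC xGV) => a b xGa xGb def_ab.
have [oa ob] : #[a] = 3 /\ #[b] = 3.
  by split; [have /imsetP[g _ ->] := xGa | have /imsetP[g _ ->] := xGb]; rewrite orderJ.
have solH : solvable <<[set a; b]>>.
  have expg3 u : #[u] = 3 -> u ^+ 3 = 1 by move=> <-; apply: expg_order.
  by apply: solvable_triangle333; apply: expg3; rewrite ?def_ab.
have [Ha Hb] : a \in <<[set a; b]>> /\ b \in <<[set a; b]>>.
  by rewrite !mem_gen ?inE ?eqxx ?orbT.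
have Hx : x \in <<[set a; b]>> by rewrite -def_ab groupM.
have sxG : x ^: G \subset G by rewrite class_subG.
have sHG : <<[set a; b]>> \subset G.
  by rewrite gen_subG subUset !sub1set !(subsetP sxG).
have leH := card_solvable_le9 small sHG Hx solH.
have sPH : P \subset <<[set a; b]>> by rewrite cycle_subG.
have sylPH : 3.-Sylow(<<[set a; b]>>) P by apply: pHall_subl sylP.
(* The index of [P] is at most 3 and prime to 3, so it is 1 or 2. Normality puts [a] in [P], and
   [a = x] would give [b = 1]. *)
have nsPH : P <| <<[set a; b]>>.
  have [_ _ p'i] := and3P sylPH; move: leH; rewrite -(Lagrange sPH) -orderE ox.
  rewrite mulnC; case def_i: #|_ : _| p'i (indexg_gt0 <<[set a; b]>> P) =>
    [|[|[|[|i]]]] // _ _ _.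
    by rewrite /normal sPH (index1g sPH def_i) normG.
  exact: index2_normal.
have Pa : a \in P by rewrite (mem_normal_Hall sylPH nsPH) // /p_elt oa.
have := ord3 a Pa; rewrite -order_eq1 oa => /(_ isT)/orP[/eqP defa|/eqP//].
by move/eqP: def_ab; rewrite defa -{2}[x]mulg1 (inj_eq (mulgI x)) -order_eq1 ob.
Qed.

(** * Elements of small order *)

Lemma solvable_order6 (gT : finGroupType) (G : {group gT}) x :
  x \in G -> #[x] = 6 -> #|solubilizer G x| <= 9 -> solvable G.
Proof.
move=> Gx ox small.
(* The order of [H] is a multiple of 6 and at most 9. *)
have over_x (H : {group gT}) : H \subset G -> x \in H -> solvable H -> H :=: <[x]>.
  move=> sHG Hx solH; have sxH : <[x]> \subset H by rewrite cycle_subG.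
  apply/eqP; rewrite eq_sym eqEcard sxH -orderE ox.
  have: 6 %| #|H| by rewrite -ox order_dvdG.
  have := card_solvable_le9 small sHG Hx solH.
  by move=> + /dvdnP[k oH]; rewrite oH; case: k {oH} => [|[|k]].
pose a := x ^+ 3; pose b := x ^+ 2; pose P := <[b]>%G.
have oa : #[a] = 2 by rewrite orderXdiv ox.
have ob : #[b] = 3 by rewrite orderXdiv ox.
have def_x : x = a * b^-1 by rewrite /a expgS -/b mulgK.
have [Ga Gb] : a \in G /\ b \in G by rewrite !groupX.
have sPG : P \subset G by rewrite cycle_subG.
have cbx : x \in 'C[b] by apply/cent1P/commuteX.
have Cx : x \in 'C_G[b] by rewrite inE Gx.
have solC : solvable 'C_G[b].
  apply: (solvable_of_central_sqr Cx).
    by rewrite -sub1set centsC (subset_trans (subsetIr _ _)) // cent_set1.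
  by apply: leq_trans small; rewrite subset_leq_card // solubilizerS ?subsetIl.
have defC : 'C_G[b] = <[x]> := over_x _ (subsetIl _ _) Cx solC.
have sCN : 'C_G[b] \subset 'N_G(P) by rewrite setIS // -cent_cycle cent_sub.
have cNb : 'C_('N_G(P))[b] = 'C_G[b].
  by rewrite setIAC; apply/setIidPl; apply: subset_trans sCN (subsetIr _ _).
(* The centralizer of [b] has order 6, and [b] has at most |P| = 3 conjugates here, so the order is
   at most 18. *)
have solN : solvable 'N_G(P).
  have oN : #|'N_G(P)| = (6 * #|b ^: 'N_G(P)|)%N.
    by rewrite -index_cent1 cNb -ox orderE -defC Lagrange.
  have lebP : #|b ^: 'N_G(P)| <= #|P|.
    apply/subset_leq_card/subsetP=> _ /imsetP[h /setIP[_ nPh] ->].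
    by rewrite memJ_norm ?cycle_id.
  apply: solvable_card_lt30; rewrite oN.
  by rewrite (leq_ltn_trans (leq_mul (leqnn 6) lebP)) // -orderE ob.
have defN := over_x _ (subsetIl _ _) (subsetP sCN x Cx) solN.
have sylP : 3.-Sylow(G) P.
  by rewrite -Sylow_subnorm pHallE /= defN cycle_subG mem_cycle -!orderE ob ox p_part.
have nCP : 'N_G(P) \subset 'C(P) by rewrite defN -defC /= cent_cycle subsetIr.
have [K [nsKG p'K abGK pGK]] := Burnside_complement sylP nCP.
have [sKG nKG] := andP nsKG.
(* The involution [a] has trivial image in the 3-group [G / K]. *)
have Ka : a \in K.
  have nKa := subsetP nKG a Ga.
  apply: coset_idr => //; apply/eqP; rewrite -order_eq1 -dvdn1.
  have co : coprime #|G / K| 2 by rewrite (pnat_coprime pGK).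
  rewrite -(eqP co) dvdn_gcd order_dvdG ?mem_quotient //= -oa.
  exact: morph_order.
have coKP : coprime #|K| #|P| by rewrite coprime_sym (pnat_coprime (pHall_pgroup sylP)).
have caP : P \subset 'N(<[a]>).
  by rewrite cents_norm // cent_cycle cycle_subG; apply/cent1P/commuteX2.
(* A [P]-invariant Sylow 2-subgroup [T] of [K] through [a] makes TP a soluble group containing [x],
   hence equal to [<[x]>]; so |T| = 2 and Burnside transfer applies for the prime 2 as well. *)
have [T [sylT nTP sXT]] :
    exists T : {group gT}, [/\ 2.-Sylow(K) T, P \subset 'N(T) & <[a]> \subset T].
  apply: sol_coprime_Sylow_subset => //.
  - exact: subset_trans nKG.
  - exact: abelian_sol (cycle_abelian b).
  - by rewrite cycle_subG.
  - by rewrite /pgroup -orderE oa.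
have [sTK pT _] := and3P sylT.
have oT : #|T| = 2.
  have defTP : T <*> P = <[x]>.
    apply: over_x; first by rewrite join_subG sPG (subset_trans sTK).
      rewrite def_x groupM ?groupV ?(subsetP (joing_subl _ _) a) -?cycle_subG //.
      exact: joing_subr.
    exact: solvable_joing nTP (pgroup_sol pT) (abelian_sol (cycle_abelian b)).
  apply/eqP; rewrite -(eqn_pmul2r (isT : 0 < 3)) -{1}ob orderE.
  rewrite -coprime_cardMg ?(coprimeSg sTK) // -norm_joinEr //.
  by rewrite [_ <*> _]defTP -orderE ox.
have sylTG : 2.-Sylow(G) T.
  rewrite pHallE (subset_trans sTK) //= (card_Hall sylT) -(Lagrange sKG) partnM //.
  rewrite -card_quotient // [X in (_ * X)%N]part_p'nat ?muln1 //.
  by apply: sub_in_pnat pGK => q _; rewrite !inE => /eqP->.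
have nCT : 'N_G(T) \subset 'C(T) by rewrite (subset_trans _ (norm_order2 oT)) ?subsetIr.
have [M [nsMG p'M abGM _]] := Burnside_complement sylTG nCT.
rewrite (solvable_abelian_quotient nsMG abGM).
have nKM : M \subset 'N(K) := subset_trans (normal_sub nsMG) nKG.
have nsKM : K :&: M <| M by rewrite /= setIC (normalGI _ nsKG) ?normal_sub.
rewrite (solvable_abelian_quotient nsKM); last first.
  rewrite (isog_abelian (second_isog nKM)).
  exact: abelianS (quotientS _ (normal_sub nsMG)) abGK.
(* [K :&: M] avoids both primes 2 and 3, so [<[x]>] acts on it coprimely. *)
apply: (solvable_coprime_action small) (cycle_id x) _ _ _ _; rewrite ?cycle_subG //.
- by rewrite subIset ?sKG.
- by rewrite -orderE ox.
- exact: abelian_sol (cycle_abelian x).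
- by rewrite (subsetP _ x Gx) // normsI // normal_norm.
rewrite -orderE ox -[6]/(2 * 3)%N coprimeMr.
rewrite (p'nat_coprime (pgroupS (subsetIr K M) p'M)) //.
exact: (p'nat_coprime (pgroupS (subsetIl K M) p'K)).
Qed.

Lemma solvable_p_elt (gT : finGroupType) (p : nat) (G : {group gT}) x :
  x \in G -> p.-elt x -> #|solubilizer G x| <= 9 -> solvable G.
Proof.
move=> Gx p_x small.
have [|x2] := eqVneq (x ^+ 2) 1.
  by move=> x2; apply: (solvable_of_central_sqr Gx) small; rewrite x2 group1.
have sxG : <[x]> \subset G by rewrite cycle_subG.
have [P sylP] := Sylow_superset sxG p_x; rewrite cycle_subG => Px.
have [sPG pP _] := and3P sylP.
have leP9 := card_solvable_le9 small sPG Px (pgroup_sol pP).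
have ox_dvd_P := order_dvdG Px; rewrite -order_dvdn in x2.
have ox_gt2 : 2 < #[x] by case: #[x] (order_gt0 x) x2 => [|[|[|]]].
have [abP | not_abP] := boolP (abelian P).
  have [leP4 | ltP4] := leqP 4 #|P|.
    exact: solvable_abelian_Sylow small sylP Px leP4 abP.
  have oP3 : #|P| = 3.
    by apply/eqP; rewrite eqn_leq -ltnS ltP4 (leq_trans ox_gt2) // dvdn_leq.
  have ox3 : #[x] = 3.
    by apply/eqP; rewrite eqn_leq ox_gt2 andbT -oP3 dvdn_leq.
  have defP : <[x]> = P by apply/eqP; rewrite eqEcard cycle_subG Px -orderE ox3 oP3.
  have p3 : p = 3 by move: p_x; rewrite /p_elt ox3 pnatE // inE => /eqP.
  by apply: solvable_Sylow3 small ox3 _; rewrite defP -p3.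
have ntP : P :!=: 1 by apply: contraNneq not_abP => ->; apply: abelian1.
have [pr_p _ [n oP]] := pgroup_pdiv pP ntP.
(* Here |P| is [p ^ n.+1], so this excludes the abelian orders p and p^2; the bound 9 then leaves
   only 8. *)
have n_gt1 : 1 < n.
  case: n oP => [|[|n]] // oP; case/negP: not_abP.
    by rewrite cyclic_abelian // prime_cyclic // oP.
  exact: card_p2group_abelian oP.
have [p2 n2] : p = 2 /\ n = 2.
  have := prime_gt1 pr_p; move: leP9; rewrite oP => le9 p_gt1.
  have le3 : p ^ 3 <= 9 by apply: leq_trans le9; rewrite leq_exp2l.
  have p2 : p = 2.
    by apply/eqP; rewrite eqn_leq p_gt1 andbT -ltnS -(ltn_exp2r _ _ (isT : 0 < 3))
      (leq_ltn_trans le3).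
  split=> //; apply/eqP; rewrite eqn_leq n_gt1 andbT -2!ltnS.
  by rewrite -(ltn_exp2l _ _ (isT : 1 < 2)); rewrite p2 in le9; apply: leq_ltn_trans le9 _.
have oP8 : #|P| = 8 by rewrite oP p2 n2.
rewrite p2 in sylP; apply: (solvable_Sylow8 small sylP Px oP8).
(* Orders 1 and 2 are excluded by [x2], and order 8 would make [P] cyclic. *)
have : #[x] \in divisors 8 by rewrite -dvdn_divisors // -oP8.
rewrite -[divisors 8]/[:: 1; 2; 4; 8]%N !inE; case/or4P=> /eqP ox //; rewrite ?ox // in x2.
case/negP: not_abP; have <- : <[x]> = P.
  by apply/eqP; rewrite eqEcard cycle_subG Px oP8 -orderE ox.
exact: cycle_abelian.
Qed.

Theorem corollary4p7 (gT : finGroupType) (G : {group gT})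
    (insolG : ~~ solvable G) (x : gT) (xG : x \in G) :
  10 <= #|solubilizer G x|.
Proof.
rewrite leqNgt ltnS; apply: contra insolG => small.
have le_ox : #[x] <= 9.
  have sxG : <[x]> \subset G by rewrite cycle_subG.
  have := card_solvable_le9 small sxG (cycle_id x).
  by apply; apply: abelian_sol (cycle_abelian x).
have [ox6 | ox'6] := eqVneq #[x] 6; first exact: solvable_order6 small.
(* Apart from 6, every order from 1 to 9 is a prime power; for [x = 1] the default [pdiv 1 = 1]
   still makes [x] a p-element. *)
apply: (@solvable_p_elt _ (pdiv #[x]) _ x) => //; rewrite /p_elt.
by case: #[x] (order_gt0 x) le_ox ox'6; do 10?case=> //.
Qed.
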